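(* Let $\alpha\in(0,1)$, let $(\xi_a)_{a\ge1}$ be i.i.d. with law $\nu$, and let $T_\alpha$ be independent of $(\xi_a)$ with $\mathbb{P}(T_\alpha=t)=(1-\alpha)\alpha^t$, $t=0,1,2,\ldots$. Consider the $(q-1)$-dimensional point process whose $k$-th component has points $\xi_1[k],\ldots,\xi_{T_\alpha}[k]$, $k=1,\ldots,q-1$, and let $Y=(Y[1],\ldots,Y[q-1])$ be the products of points, $Y[k]=\prod_{b=1}^{T_\alpha}\xi_b[k]$ (empty product equal to $1$). Then the joint probability generating functional of the point process is $$G[f_1,\ldots,f_{q-1}]:=\mathbb{E}\Big[\prod_{b=1}^{T_\alpha}\int\prod_{k=1}^{q-1}f_k(\xi_b[k])\,\nu(d\xi_b)\Big]=\frac{1}{1+\frac{\alpha}{1-\alpha}\int\big(1-\prod_{k=1}^{q-1}f_k(\xi[k])\big)\nu(d\xi)}$$ for measurable functions $f_1,\ldots,f_{q-1}$ from the closed complex unit disc to itself, and for every vector $l=(l[1],\ldots,l[q-1])$ of nonnegative integers $$\frac{1}{1+\frac{\alpha}{1-\alpha}(1-\kappa_l)}=\mathbb{E}\Big[\prod_{k=1}^{q-1}Y[k]^{l[k]}\Big].$$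
   Context: Let $q\ge2$, $\theta_1=e^{2\pi i/q}$. Let $\mu$ be a probability measure (de Finetti measure) on the set of probability distributions $p=(p[0],\ldots,p[q-1])$ on $\{0,1,\ldots,q-1\}$. For such $p$ define the Fourier transform $\xi[k]=\sum_{j=0}^{q-1}\theta_1^{kj}p[j]$, $k=0,\ldots,q-1$ (so $\xi[0]=1$), and let $\nu$ be the law of $\xi=(\xi[0],\ldots,\xi[q-1])$ when $p$ has law $\mu$. All integrals against $\nu$ are over the set of such Fourier transforms. The grouped eigenvalues of the de Finetti random walk (whose increments have entries that are, conditionally on $p\sim\mu$, i.i.d. with distribution $p$) are $$\kappa_l=\int\prod_{k=1}^{q-1}\Big(\sum_{j=0}^{q-1}\theta_1^{kj}p[j]\Big)^{l[k]}\mu(dp)=\int\prod_{k=1}^{q-1}\xi[k]^{l[k]}\,\nu(d\xi).$$ *)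

(* Defs.v *)
From HB Require Import structures.
From mathcomp Require Import all_boot all_order all_algebra.
From mathcomp Require Import all_classical all_reals all_analysis.
From mathcomp Require Import measurable_realfun complex.

Set Implicit Arguments.
Unset Strict Implicit.
Unset Printing Implicit Defensive.

Import Order.TTheory GRing.Theory Num.Theory.
Import numFieldNormedType.Exports.

Local Open Scope classical_set_scope.
Local Open Scope ring_scope.
Local Open Scope complex_scope.

(* The Borel sigma-algebra of C, transported from R * R along z |-> (Re z, Im z). *)
Section complex_measurable.
Context {R : realType}.

Definition complex_pair (z : R[i]) : R * R :=
  (complex.Re z, complex.Im z).

Definition complex_measurable : set (set R[i]) :=
  preimage_set_system setT complex_pair measurable.

Let sigma_complex : sigma_algebra setT complex_measurable.
Proof. by apply: sigma_algebra_preimage; exact: sigma_algebra_measurable. Qed.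

Let complex_measurable0 : complex_measurable set0.
Proof. by case: sigma_complex. Qed.

Let complex_measurableC A : complex_measurable A -> complex_measurable (~` A).
Proof. by case: sigma_complex => _ + _ => /[apply]; rewrite setTD. Qed.

Let complex_measurable_bigcup (F : (set R[i])^nat) :
  (forall i, complex_measurable (F i)) -> complex_measurable (\bigcup_i F i).
Proof. by case: sigma_complex => _ _; apply. Qed.

HB.instance Definition _ := isPointed.Build R[i] 0.

HB.instance Definition _ := @isMeasurable.Build (preimage_display complex_pair)
  R[i] complex_measurable complex_measurable0 complex_measurableC
  complex_measurable_bigcup.

End complex_measurable.

Lemma measurable_complexP (R : realType) d (T : measurableType d)
    (f : T -> R[i]) :
  measurable_fun setT f <->
  measurable_fun setT (fun x => complex.Re (f x) : R) /\
  measurable_fun setT (fun x => complex.Im (f x) : R).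
Proof.
have mpair : measurable_fun setT (@complex_pair R).
  by move=> _ B mB; exists B.
split=> [mf|[mr mi]].
  by split; [apply: (measurableT_comp (f := fst \o @complex_pair R)) => //|
             apply: (measurableT_comp (f := snd \o @complex_pair R)) => //];
     apply: measurableT_comp.
move=> _ _ [B mB <-]; rewrite setTI setTI -comp_preimage.
rewrite -[X in measurable X]setTI.
have /(_ measurableT B mB) // : measurable_fun setT (@complex_pair R \o f).
exact: measurable_fun_pair.
Qed.

Section complex_integral.
Context {R : realType} {d : measure_display} {T : measurableType d}.

Definition Cintegral (m : {measure set T -> \bar R}) (f : T -> R[i]) : R[i] :=
  (\int[m]_x complex.Re (f x)) +i* (\int[m]_x complex.Im (f x)).

End complex_integral.

Notation "\intC [ m ]_ x f" := (Cintegral m (fun x => f))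
  (at level 36, m at level 10, x name, f at level 36) : ring_scope.

Definition closed_disc (R : realType) : set R[i] := [set z | `|z| <= 1].
Arguments closed_disc : clear implicits.

Notation frequency q := {k : 'I_q | (0 < k)%N}.

Section fourier_transform.
Context (R : realType) (q : nat).

Definition theta1 : R[i] := cos (2 * pi / q%:R) +i* sin (2 * pi / q%:R).

Definition simplex_set : set {ffun 'I_q -> R} :=
  [set p | (forall j, 0 <= p j) /\ \sum_j p j = 1].

Definition dft (p : {ffun 'I_q -> R}) : {ffun 'I_q -> R[i]} :=
  [ffun k : 'I_q => \sum_(j < q) theta1 ^+ (k * j) * (p j)%:C].

End fourier_transform.

(* The bound hq is a parameter of the two types below because measurable types
   must be inhabited. *)
Section distributions.
Context (R : realType) (q : nat).

Definition simplex (hq : (2 <= q)%N) : Type := set_type (@simplex_set R q).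

Definition spectrum (hq : (2 <= q)%N) : Type :=
  set_type (@dft R q @` @simplex_set R q).

Variable hq : (2 <= q)%N.

Definition mass (j : 'I_q) (p : simplex hq) : R := val p j.

Definition coef (k : 'I_q) (x : spectrum hq) : R[i] := val x k.

Let dirac_mass : {ffun 'I_q -> R} :=
  [ffun j => (j == Ordinal (ltnW hq))%:R].

Let dirac_massP : dirac_mass \in @simplex_set R q.
Proof.
rewrite inE; split=> [j|]; first by rewrite ffunE ler0n.
rewrite (bigD1 (Ordinal (ltnW hq))) //= ffunE eqxx big1 ?addr0 // => j jn.
by rewrite ffunE (negbTE jn).
Qed.

Let fourier_subproof (p : simplex hq) :
  dft (val p) \in @dft R q @` @simplex_set R q.
Proof. by rewrite inE; exists (val p) => //; exact: set_valP. Qed.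

Definition fourier (p : simplex hq) : spectrum hq :=
  exist (fun x => x \in _) _ (fourier_subproof p).

HB.instance Definition _ := Choice.on (simplex hq).
HB.instance Definition _ := Choice.on (spectrum hq).
HB.instance Definition _ := isPointed.Build (simplex hq)
  (exist (fun p => p \in _) _ dirac_massP).
HB.instance Definition _ := isPointed.Build (spectrum hq) (fourier point).

HB.instance Definition _ := @isMeasurable.Build default_measure_display
  (simplex hq) (g_sigma_preimage mass)
  (@sigma_algebra0 _ setT _) (@sigma_algebraC _ _) (@sigma_algebra_bigcup _ setT _).

HB.instance Definition _ := @isMeasurable.Build default_measure_display
  (spectrum hq) (g_sigma_preimage coef)
  (@sigma_algebra0 _ setT _) (@sigma_algebraC _ _) (@sigma_algebra_bigcup _ setT _).

End distributions.

Section fourier_measurable.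
Context (R : realType) (q : nat) (hq : (2 <= q)%N).

Lemma measurable_mass (j : 'I_q) :
  measurable_fun setT (mass j : simplex R hq -> R).
Proof.
move=> _ B mB; apply: sub_sigma_algebra.
by rewrite (bigD1 j) //=; left; exists B.
Qed.

Lemma measurable_spectrum d (T : measurableType d) (g : T -> spectrum R hq) :
  (forall k, measurable_fun setT (coef k \o g)) -> measurable_fun setT g.
Proof.
move=> mg; apply: (measurability (\big[setU/set0]_(k < q)
  preimage_set_system setT (coef (hq := hq) k) measurable)) => //.
move=> _ [B /= + <-]; rewrite setTI.
apply: (big_ind (fun A : set (set (spectrum R hq)) =>
  A B -> measurable (g @^-1` B))) => //.
- by move=> A1 A2 h1 h2 [/h1|/h2].
- move=> k _ [D mD <-]; rewrite setTI -comp_preimage -[X in measurable X]setTI.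
  exact: mg.
Qed.

Lemma measurable_fourier : measurable_fun setT (@fourier R q hq).
Proof.
apply: measurable_spectrum => k; apply/measurable_complexP.
pose c (j : 'I_q) := theta1 R q ^+ (k * j).
have cE p : coef k (@fourier R q hq p) =
    (\sum_(j < q) complex.Re (c j) * mass j p) +i*
    (\sum_(j < q) complex.Im (c j) * mass j p).
  rewrite /coef/= ffunE; apply/eqP; rewrite eq_complex.
  rewrite (raddf_sum (@complex.Re R)) (raddf_sum (@complex.Im R)) /c/=.
  by apply/andP; split; apply/eqP; apply: eq_bigr => j _;
     case: (theta1 R q ^+ _) => x y /=; rewrite mulr0 ?subr0 ?add0r.
split.
- have -> : (fun p => complex.Re ((coef k \o @fourier R q hq) p)) =
      (fun p => \sum_(j < q) complex.Re (c j) * mass j p).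
    by apply/funext => p; rewrite /comp cE.
  by apply: measurable_sum => j; apply: measurable_funM => //; exact: measurable_mass.
- have -> : (fun p => complex.Im ((coef k \o @fourier R q hq) p)) =
      (fun p => \sum_(j < q) complex.Im (c j) * mass j p).
    by apply/funext => p; rewrite /comp cE.
  by apply: measurable_sum => j; apply: measurable_funM => //; exact: measurable_mass.
Qed.

HB.instance Definition _ :=
  isMeasurableFun.Build _ _ _ _ (@fourier R q hq) measurable_fourier.

End fourier_measurable.

Section independence.
Context {R : realType} {d d1 d2 : measure_display}.
Context {Omega : measurableType d} {S : measurableType d1} {U : measurableType d2}.
Variable P : probability Omega R.

Definition mutually_independent (X : nat -> {RV P >-> S}) : Prop :=
  forall (J : seq nat) (A : nat -> set S), uniq J -> (forall a, measurable (A a)) ->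
    P (\bigcap_(a in [set` J]) (X a @^-1` A a)) =
    (\prod_(a <- J) P (X a @^-1` A a))%E.

Definition sigma_of_sequence (X : nat -> {RV P >-> S}) : set (set Omega) :=
  <<s \bigcup_a preimage_set_system setT (X a) measurable >>.

Definition independent_of_sequence (Z : {RV P >-> U}) (X : nat -> {RV P >-> S}) :
    Prop :=
  forall (B : set U) (E : set Omega), measurable B -> sigma_of_sequence X E ->
    P (Z @^-1` B `&` E) = (P (Z @^-1` B) * P E)%E.

Definition has_law (X : {RV P >-> S}) (m : probability S R) : Prop :=
  forall A : set S, measurable A -> distribution P X A = m A.

End independence.

Section de_finetti.
Context (R : realType) (q : nat) (hq : (2 <= q)%N).
Variable mu : probability (simplex R hq) R.

Definition nu : probability (spectrum R hq) R := distribution mu (@fourier R q hq).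

Definition kappa (l : frequency q -> nat) : R[i] :=
  \intC[mu]_p \prod_(k : frequency q)
    (\sum_(j < q) theta1 R q ^+ (val k * j) * (mass j p)%:C) ^+ l k.

End de_finetti.

Section point_process.
Context {R : realType} {q : nat} {hq : (2 <= q)%N} {d : measure_display}.
Context {Omega : measurableType d} {P : probability Omega R}.

(* The sequence xi is indexed from 0, so that its first T terms are
   xi 0, ..., xi (T - 1). *)
Definition point_process (xi : nat -> {RV P >-> spectrum R hq}) (T : {RV P >-> nat})
    (k : frequency q) (w : Omega) : seq R[i] :=
  [seq coef (val k) (xi b w) | b <- iota 0 (T w)].

Definition product_of_points (N : frequency q -> Omega -> seq R[i])
    (k : frequency q) (w : Omega) : R[i] :=
  \prod_(z <- N k w) z.

End point_process.

Definition joint_pgfl (R : realType) (d : measure_display) (Omega : measurableType d)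
    (P : probability Omega R) (I : finType) (N : I -> Omega -> seq R[i])
    (f : I -> R[i] -> R[i]) : R[i] :=
  \intC[P]_w \prod_(k : I) \prod_(z <- N k w) f k z.

(* Main.v *)
Require Import Defs.
From HB Require Import structures.
From mathcomp Require Import all_boot all_order all_algebra.
From mathcomp Require Import all_classical all_reals all_analysis.
From mathcomp Require Import measurable_realfun complex.
From mathcomp Require Import ring lra.
Set Implicit Arguments.
Unset Strict Implicit.
Unset Printing Implicit Defensive.
Import Order.TTheory GRing.Theory Num.Theory.
Import numFieldNormedType.Exports.
Local Open Scope classical_set_scope.
Local Open Scope ring_scope.
Local Open Scope complex_scope.

(** Everything reduces to one statement about a bounded measurable function [h]
    on the spectrum. With [c] the mean of [h] under the common law of the [xi b],
    and [T] geometric and independent of the sequence, the product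
    [\prod_(b < T) h (xi b)] and the power [c ^+ T] both have mean
    [1 / (1 + alpha / (1 - alpha) * (1 - c))]. For the generating functional,
    [h x] is the product over [k] of [f k (x k)]; for the moments of the products
    of points, [h x] is the product over [k] of [x k ^+ l k], whose mean is the
    eigenvalue [kappa mu l].

    On the event [T = t] the product has [t] factors, so independence gives the
    partial expectation [(1 - alpha) * (alpha * c) ^+ t], and the geometric series
    sums to [(1 - alpha) / (1 - alpha * c)] because [`|c| <= 1]. Three points
    carry the proof.

    - Independence is a product rule for events, whereas a product rule for
      complex functions is needed. [Cintegral_mul_indep] trades a single
      indicator for a function: if multiplying a fixed [Z] by any event of [X]
      factorizes the mean, so does multiplying it by any bounded measurable
      function of [X]. [Cintegral_prod_cylinder] starts from the product rule for
      events and performs this exchange on one variable of the sequence at a time.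
    - [Cintegral_geometric_mixture] sums the series with finite sums only. The
      part of the mean carried by [n <= T] and the remainder of the series from
      rank [n] on satisfy the same recursion, so that their difference does not
      depend on [n]; and it tends to [0].
    - [Cintegral_le_norm], the triangle inequality for complex integrals, gives
      [`|c| <= 1] and bounds the tails. *)

(** * Bounded measurable complex functions and their integrals *)

Section complex_parts.
Context {R : realType}.
Implicit Types z u : R[i].

Lemma ReM z u :
  complex.Re (z * u) = complex.Re z * complex.Re u - complex.Im z * complex.Im u.
Proof. by case: z u => a b [a' b']. Qed.

Lemma ImM z u :
  complex.Im (z * u) = complex.Re z * complex.Im u + complex.Im z * complex.Re u.
Proof. by case: z u => a b [a' b'] /=; rewrite [b * a']mulrC. Qed.

Lemma ReD z u : complex.Re (z + u) = complex.Re z + complex.Re u.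
Proof. by case: z u => a b []. Qed.

Lemma ImD z u : complex.Im (z + u) = complex.Im z + complex.Im u.
Proof. by case: z u => a b []. Qed.

Lemma complex_eq z u :
  complex.Re z = complex.Re u -> complex.Im z = complex.Im u -> z = u.
Proof. by case: z u => a b [a' b'] /= -> ->. Qed.

Lemma Re_le_norm (M : R) z : `|z| <= M%:C -> `|complex.Re z| <= M.
Proof. by move=> zM; rewrite -lecR (le_trans (normc_ge_Re z)). Qed.

Lemma Im_le_norm (M : R) z : `|z| <= M%:C -> `|complex.Im z| <= M.
Proof.
move=> zM; rewrite -normrN -ReiNIm; apply: Re_le_norm.
by rewrite normrM [`|'i|](_ : _ = 1) ?mulr1// normc_def/= expr0n expr1n add0r sqrtr1.
Qed.

End complex_parts.

Section bounded_measurable.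
Context {R : realType} {d : measure_display} {T : measurableType d}.
Implicit Types F G : T -> R[i].

Definition bounded_measurable F :=
  measurable_fun setT F /\ exists M : R, forall w, `|F w| <= M%:C.

Lemma bounded_measurable_cst (c : R[i]) : bounded_measurable (fun=> c).
Proof.
split; first exact: measurable_cst.
by exists (complex.Re `|c|) => _; rewrite RRe_real ?normr_real.
Qed.

Lemma bounded_measurable_add F G : bounded_measurable F ->
  bounded_measurable G -> bounded_measurable (fun w => F w + G w).
Proof.
move=> [/measurable_complexP[mFr mFi] [M FM]] [/measurable_complexP[mGr mGi] [N GN]].
split; last first.
  by exists (M + N) => w; rewrite rmorphD (le_trans (ler_normD _ _)) ?lerD.
apply/measurable_complexP; split.
- by under eq_fun do rewrite ReD; exact: measurable_funD.
- by under eq_fun do rewrite ImD; exact: measurable_funD.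
Qed.

Lemma bounded_measurable_mul F G : bounded_measurable F ->
  bounded_measurable G -> bounded_measurable (fun w => F w * G w).
Proof.
move=> [/measurable_complexP[mFr mFi] [M FM]] [/measurable_complexP[mGr mGi] [N GN]].
split; last first.
  by exists (M * N) => w; rewrite rmorphM normrM ler_pM.
apply/measurable_complexP; split.
- by under eq_fun do rewrite ReM; apply: measurable_funB; exact: measurable_funM.
- by under eq_fun do rewrite ImM; apply: measurable_funD; exact: measurable_funM.
Qed.

Lemma bounded_measurable_prod (I : Type) (r : seq I) (F : I -> T -> R[i]) :
  (forall i, bounded_measurable (F i)) ->
  bounded_measurable (fun w => \prod_(i <- r) F i w).
Proof.
move=> bF; elim: r => [|i r IHr].
  by under eq_fun do rewrite big_nil; exact: bounded_measurable_cst.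
by under eq_fun do rewrite big_cons; exact: bounded_measurable_mul.
Qed.

Lemma bounded_measurable_exp F n : bounded_measurable F ->
  bounded_measurable (fun w => F w ^+ n).
Proof.
move=> bF; elim: n => [|n IHn]; first exact: bounded_measurable_cst.
by under eq_fun do rewrite exprS; exact: bounded_measurable_mul.
Qed.

Lemma bounded_measurable_indic (A : set T) : measurable A ->
  bounded_measurable (fun w => (\1_A w : R)%:C).
Proof.
move=> mA; split.
  apply/measurable_complexP; split => /=; first exact: measurable_indic.
  exact: measurable_cst.
exists 1 => w; rewrite indicE.
by case: (w \in A); rewrite ?normr1// normr0 rmorph1.
Qed.

End bounded_measurable.

Lemma bounded_measurable_comp (R : realType) d d' (T : measurableType d)
    (T' : measurableType d') (phi : T' -> T) (F : T -> R[i]) :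
  measurable_fun setT phi -> bounded_measurable F -> bounded_measurable (F \o phi).
Proof.
move=> mphi [mF [M FM]]; split; first exact: measurableT_comp.
by exists M => w; exact: FM.
Qed.


Section complex_expectation.
Context {R : realType} {d : measure_display} {T : measurableType d}.
Variable P : probability T R.
Implicit Types F G : T -> R[i].

Lemma bounded_integrable (f : T -> R) (M : R) : measurable_fun setT f ->
  (forall w, `|f w| <= M) -> P.-integrable setT (EFin \o f).
Proof.
move=> mf fM; apply: measurable_bounded_integrable => //.
  by rewrite (le_lt_trans (probability_le1 P _))// ltry.
exists M; split; rewrite ?num_real// => x Mx w _;
  exact: le_trans (fM w) (ltW Mx).
Qed.

Lemma integrable_Re F : bounded_measurable F ->
  P.-integrable setT (EFin \o (fun w => complex.Re (F w))).
Proof.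
move=> [/measurable_complexP[mF _] [M FM]].
by apply: (bounded_integrable (M := M)) => // w; exact: Re_le_norm.
Qed.

Lemma integrable_Im F : bounded_measurable F ->
  P.-integrable setT (EFin \o (fun w => complex.Im (F w))).
Proof.
move=> [/measurable_complexP[_ mF] [M FM]].
by apply: (bounded_integrable (M := M)) => // w; exact: Im_le_norm.
Qed.

Lemma eq_Cintegral F G : F =1 G -> \intC[P]_w F w = \intC[P]_w G w.
Proof. by move=> /funext ->. Qed.

Lemma Cintegral_cst (c : R[i]) : \intC[P]_w c = c.
Proof.
have PT : fine (P setT) = 1 by rewrite (_ : P setT = 1%E)// probability_setT.
by rewrite /Cintegral !Rintegral_cst// PT !mulr1; case: c.
Qed.

Lemma CintegralD F G : bounded_measurable F -> bounded_measurable G ->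
  \intC[P]_w (F w + G w) = \intC[P]_w F w + \intC[P]_w G w.
Proof.
move=> bF bG; apply: complex_eq => /=.
- under eq_Rintegral do rewrite ReD.
  by rewrite RintegralD//; exact: integrable_Re.
- under eq_Rintegral do rewrite ImD.
  by rewrite RintegralD//; exact: integrable_Im.
Qed.

Lemma CintegralZl (c : R[i]) F : bounded_measurable F ->
  \intC[P]_w (c * F w) = c * \intC[P]_w F w.
Proof.
move=> bF; have iR := integrable_Re bF; have iI := integrable_Im bF.
have iZ (k : R) f : P.-integrable setT (EFin \o f) ->
    P.-integrable setT (EFin \o (fun w => k * f w)).
  by move=> /(integrableZl measurableT k); apply: eq_integrable => // w _.
apply: complex_eq; rewrite ?ReM ?ImM /=.
- under eq_Rintegral do rewrite ReM.
  by rewrite RintegralB ?RintegralZl//; exact: iZ.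
- under eq_Rintegral do rewrite ImM.
  by rewrite RintegralD ?RintegralZl//; exact: iZ.
Qed.

Lemma Cintegral_indic (A : set T) : measurable A ->
  \intC[P]_w (\1_A w : R)%:C = (fine (P A))%:C.
Proof.
move=> mA; rewrite /Cintegral /= Rintegral_cst// mul0r.
by rewrite /Rintegral integral_indic// setIT.
Qed.

(** Multiplying by the conjugate of the integral [c] turns the integral into the
    real number [`|c| ^+ 2], which is the integral of the real part of
    [c^* * F]; that real part is at most [`|c| * g]. *)
Lemma Cintegral_le_norm F (g : T -> R) : bounded_measurable F ->
  P.-integrable setT (EFin \o g) -> (forall w, `|F w| <= (g w)%:C) ->
  `|\intC[P]_w F w| <= (\int[P]_w g w)%:C.
Proof.
move=> bF ig Fg; set c := Cintegral _ _.
have [-> |c0] := eqVneq c 0.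
  rewrite normr0 ler0c; apply: Rintegral_ge0 => w _.
  by rewrite -ler0c (le_trans _ (Fg w)).
have cR : `|c| = (complex.Re `|c|)%:C by rewrite RRe_real ?normr_real.
set r := complex.Re `|c| in cR.
have r0 : 0 < r by rewrite -ltcR -cR normr_gt0.
rewrite cR lecR -(ler_pM2l r0).
have -> : r * r = complex.Re (\intC[P]_w (conjc c * F w)).
  transitivity (complex.Re (`|c| ^+ 2)); first by rewrite cR expr2 -rmorphM.
  by rewrite CintegralZl// -/c mulrC -sqr_normc.
rewrite -RintegralZl//=; apply: le_Rintegral => //.
- apply: integrable_Re; apply: bounded_measurable_mul => //.
  exact: bounded_measurable_cst.
- by move: (integrableZl measurableT r ig); apply: eq_integrable.
- move=> w _; rewrite (le_trans (ler_norm _))//; apply: Re_le_norm.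
  have cJ : `|conjc c| = `|c| by exact: normcJ.
  by rewrite normrM cJ cR rmorphM ler_wpM2l// -cR.
Qed.

End complex_expectation.

(** * From product rules for events to product rules for functions *)

Section decorrelation.
Context {R : realType} {d d' : measure_display}.
Context {T : measurableType d} {S : measurableType d'}.
Variables (P : probability T R) (X : T -> S).
Hypothesis mX : measurable_fun setT X.

Lemma Cintegral_real (f : T -> R) :
  \intC[P]_w (f w)%:C = (\int[P]_w f w)%:C.
Proof. by rewrite /Cintegral /= Rintegral_cst// mul0r. Qed.

Let measurable_preimX (B : set S) : measurable B -> measurable (X @^-1` B).
Proof. by move=> mB; rewrite -[X @^-1` B]setTI; exact: mX. Qed.

Import HBNNSimple.

(** A simple function is a combination of indicators of its fibres, so the rule
    follows by linearity. The number [u] stands for the mean of [U]; the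
    choice [U = 1], [u = 1] computes the mean of [f (X w)] itself. *)
Let ge0_integral_mul_nnsfun (U : T -> R) (M u : R) (f : {nnsfun S >-> R}) :
  measurable_fun setT U -> (forall w, 0 <= U w <= M) ->
  (forall B, measurable B ->
    (\int[P]_w (U w * \1_B (X w))%:E = u%:E * P (X @^-1` B))%E) ->
  (\int[P]_w (U w * f (X w))%:E =
   (u * \sum_(k <- finmap.enum_fset (fset_set (range f)))
          k * fine (P (X @^-1` (f @^-1` [set k]))))%:E)%E.
Proof.
move=> mU UM HU.
have m1 B : measurable B -> measurable_fun setT (fun w => \1_B (X w) : R).
  by move=> mB; exact: measurableT_comp.
have U0 w : 0 <= U w by case/andP: (UM w).
have mf k : measurable (f @^-1` [set k]) by [].
have k0 k w : 0 <= k * \1_(f @^-1` [set k]) (X w).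
  by rewrite -lee_fin EFinM nnfun_muleindic_ge0.
transitivity (\int[P]_w \sum_(k <- finmap.enum_fset (fset_set (range f)))
    (U w * (k * \1_(f @^-1` [set k]) (X w)))%:E)%E.
  apply: eq_integral => w _.
  by rewrite sumEFin -mulr_sumr fimfunE fsbig_finite.
rewrite ge0_integral_sum//; first last.
- by move=> k w _; rewrite lee_fin mulr_ge0.
- move=> k; apply/measurable_EFinP; apply: measurable_funM => //.
  by apply: measurable_funM => //; exact: m1.
rewrite mulr_sumr -sumEFin; apply: eq_bigr => k _.
rewrite mulrCA !EFinM fineK ?fin_num_measure//; last exact: measurable_preimX.
rewrite -HU//.
under eq_integral do rewrite mulrCA EFinM.
rewrite integralZl//.
apply: (@bounded_integrable _ _ _ P _ M) => [|w].
  by apply: measurable_funM => //; exact: m1.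
rewrite indicE ger0_norm ?mulr_ge0//.
have /andP[Uw0 UwM] := UM w.
by case: (_ \in _); rewrite ?mulr1// mulr0 (le_trans Uw0).
Qed.

(** Monotone convergence along simple functions increasing to [g]. Both sides are
    limits of the same sequence: the left one directly, the right one by the same
    argument with [U] replaced by the constant [1]. *)
Let ge0_integral_mul (U : T -> R) (M u : R) (g : S -> R) :
  measurable_fun setT U -> (forall w, 0 <= U w <= M) ->
  measurable_fun setT g -> (forall x, 0 <= g x) ->
  (forall B, measurable B ->
    (\int[P]_w (U w * \1_B (X w))%:E = u%:E * P (X @^-1` B))%E) ->
  (\int[P]_w (U w * g (X w))%:E = u%:E * \int[P]_w (g (X w))%:E)%E.
Proof.
move=> mU UM mg g0 HU.
have mEg : measurable_fun setT (EFin \o g) by exact/measurable_EFinP.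
pose g_ := nnsfun_approx measurableT mEg.
have g_cvg x : (g_ n x)%:E @[n --> \oo] --> (g x)%:E.
  by apply: cvg_nnsfun_approx => // y _; rewrite lee_fin.
have ndg x : {homo g_ ^~ x : m n / (m <= n)%N >-> m <= n}.
  by move=> m n mn; exact/lefP/nd_nnsfun_approx.
have cvg_int (V : T -> R) : measurable_fun setT V -> (forall w, 0 <= V w) ->
    (\int[P]_w (V w * g_ n (X w))%:E)%E @[n --> \oo] -->
    (\int[P]_w (V w * g (X w))%:E)%E.
  move=> mV V0.
  have -> : (\int[P]_w (V w * g (X w))%:E)%E =
      (\int[P]_w limn (fun n => (V w * g_ n (X w))%:E))%E.
    apply: eq_integral => w _; apply/esym/cvg_lim => //.
    by rewrite EFinM; under eq_fun do rewrite EFinM; exact: cvgeZl.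
  apply: (@cvg_monotone_convergence _ _ _ P setT measurableT
    (fun n w => (V w * g_ n (X w))%:E)).
  - move=> n; apply/measurable_EFinP; apply: measurable_funM => //.
    exact: measurableT_comp.
  - by move=> n w _; rewrite lee_fin mulr_ge0.
  - by move=> w _ m n mn; rewrite lee_fin ler_wpM2l// ndg.
have cvg1 := cvg_int (cst 1) (measurable_cst _) (fun=> ler01).
have H1 B : measurable B ->
    (\int[P]_w (1 * \1_B (X w) : R)%:E = 1%:E * P (X @^-1` B))%E.
  move=> mB; rewrite mul1e.
  transitivity (\int[P]_w (\1_(X @^-1` B) w)%:E)%E.
    by apply: eq_integral => w _; rewrite mul1r.
  by rewrite integral_indic ?setIT//; exact: measurable_preimX.
have -> : (\int[P]_w (g (X w))%:E)%E = (\int[P]_w (cst 1 w * g (X w))%:E)%E.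
  by apply: eq_integral => w _; rewrite mul1r.
apply: cvg_unique (cvg_int U mU _) _ => //; first by move=> w; case/andP: (UM w).
rewrite (_ : (fun _ => _) = fun n => (u%:E * \int[P]_w (cst 1 w * g_ n (X w))%:E)%E).
  exact: cvgeZl.
apply/funext => n; rewrite (ge0_integral_mul_nnsfun _ mU UM HU).
rewrite (@ge0_integral_mul_nnsfun (cst 1) 1 1 _ _ _ H1)//.
  by rewrite mul1r.
by move=> w /=; rewrite ler01 lexx.
Qed.

Let real_bounded (f : T -> R) (M : R) : measurable_fun setT f ->
  (forall w, `|f w| <= M) -> bounded_measurable (fun w => (f w)%:C).
Proof.
move=> mf fM; split.
  by apply/measurable_complexP; split => //=; exact: measurable_cst.
by exists M => w; rewrite normc_def/= expr0n addr0 sqrtr_sqr lecR.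
Qed.

Lemma Cintegral_mul_ge0 (U : T -> R) (M : R) (g : S -> R) (N : R) :
  measurable_fun setT U -> (forall w, 0 <= U w <= M) ->
  measurable_fun setT g -> (forall x, 0 <= g x <= N) ->
  (forall B, measurable B -> \intC[P]_w ((U w)%:C * (\1_B (X w) : R)%:C) =
    \intC[P]_w (U w)%:C * (fine (P (X @^-1` B)))%:C) ->
  \intC[P]_w ((U w)%:C * (g (X w))%:C) =
  \intC[P]_w (U w)%:C * \intC[P]_w (g (X w))%:C.
Proof.
move=> mU UM mg gN HU.
have nng (V : T -> R) K : (forall w, 0 <= V w <= K) -> forall w, `|V w| <= K.
  by move=> VK w; have /andP[V0 ?] := VK w; rewrite ger0_norm.
have fin (V : T -> R) K : measurable_fun setT V -> (forall w, 0 <= V w <= K) ->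
    (\int[P]_w (V w)%:E \is a fin_num)%E.
  move=> mV VK; apply: (@integrable_fin_num _ _ _ P setT measurableT).
  exact: (@bounded_integrable _ _ _ P V K mV (nng _ _ VK)).
have mgX : measurable_fun setT (g \o X) by exact: measurableT_comp.
have HR B : measurable B ->
    (\int[P]_w (U w * \1_B (X w))%:E = (\int[P]_w U w)%:E * P (X @^-1` B))%E.
  move=> mB; have mXB := measurable_preimX mB.
  have := HU _ mB; under eq_Cintegral do rewrite -rmorphM /=.
  rewrite !Cintegral_real -rmorphM => /complexI.
  rewrite /Rintegral => HE; rewrite -[LHS]fineK; last first.
    apply: (fin _ M); first by apply: measurable_funM => //; exact: measurableT_comp.
    move=> w; have /andP[Uw0 UwM] := UM w; rewrite indicE.
    have [_|_] := boolP (X w \in B); first by rewrite mulr1 Uw0.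
    by rewrite mulr0 lexx (le_trans Uw0).
  by rewrite HE EFinM [(fine (P _))%:E]fineK// fin_num_measure.
under eq_Cintegral do rewrite -rmorphM /=.
rewrite !Cintegral_real -rmorphM; congr (_%:C).
rewrite {1}/Rintegral (@ge0_integral_mul U M _ g mU UM mg _ HR); last first.
  by move=> x; case/andP: (gN x).
rewrite fineM//; apply: (fin _ N mgX) => w; exact: gN.
Qed.

(** Adding a constant to [U] and to [g] makes both nonnegative and only changes
    the two sides by terms that already factorize. *)
Lemma Cintegral_mul_real (U : T -> R) (M : R) (g : S -> R) (N : R) :
  measurable_fun setT U -> (forall w, `|U w| <= M) ->
  measurable_fun setT g -> (forall x, `|g x| <= N) ->
  (forall B, measurable B -> \intC[P]_w ((U w)%:C * (\1_B (X w) : R)%:C) =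
    \intC[P]_w (U w)%:C * (fine (P (X @^-1` B)))%:C) ->
  \intC[P]_w ((U w)%:C * (g (X w))%:C) =
  \intC[P]_w (U w)%:C * \intC[P]_w (g (X w))%:C.
Proof.
move=> mU UM mg gN HU.
have bU : bounded_measurable (fun w => (U w)%:C) by exact: real_bounded UM.
have bg : bounded_measurable (fun w => (g (X w))%:C).
  by apply: (real_bounded (M := N)) => //; exact: measurableT_comp.
have shift (a b : R) : `|a| <= b -> 0 <= a + b <= b + b.
  by rewrite ler_norml => /andP[? ?]; rewrite -lerBlDr sub0r lerD2r; apply/andP.
have := @Cintegral_mul_ge0 (fun w => U w + M) (M + M) (fun x => g x + N) (N + N).
have bc c : bounded_measurable (fun _ : T => c) by exact: bounded_measurable_cst.
have EU c : \intC[P]_w (U w + c)%:C = \intC[P]_w (U w)%:C + c%:C.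
  under eq_Cintegral do rewrite rmorphD.
  by rewrite CintegralD// Cintegral_cst.
have Eg c : \intC[P]_w (g (X w) + c)%:C = \intC[P]_w (g (X w))%:C + c%:C.
  under eq_Cintegral do rewrite rmorphD.
  by rewrite CintegralD// Cintegral_cst.
rewrite EU Eg => H.
have {}H := H (measurable_funD mU (measurable_cst _)) (fun w => shift _ _ (UM w))
  (measurable_funD mg (measurable_cst _)) (fun x => shift _ _ (gN x)).
transitivity ((\intC[P]_w (U w)%:C + M%:C) * (\intC[P]_w (g (X w))%:C + N%:C)
   - N%:C * \intC[P]_w (U w)%:C - M%:C * \intC[P]_w (g (X w))%:C - M%:C * N%:C);
  last by ring.
rewrite -H; last first.
  move=> B mB; have b1 : bounded_measurable (fun w => (\1_B (X w) : R)%:C).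
    exact: bounded_measurable_indic (measurable_preimX mB).
  under eq_Cintegral do rewrite rmorphD mulrDl.
  rewrite CintegralD ?CintegralZl//; [|exact: bounded_measurable_mul..].
  by rewrite HU// mulrDl (Cintegral_indic P (measurable_preimX mB)).
transitivity (\intC[P]_w (((U w)%:C * (g (X w))%:C + N%:C * (U w)%:C) +
    (M%:C * (g (X w))%:C + M%:C * N%:C)) - N%:C * \intC[P]_w (U w)%:C -
    M%:C * \intC[P]_w (g (X w))%:C - M%:C * N%:C); last first.
  congr (_ - _ - _ - _); apply: eq_Cintegral => w.
  by rewrite !rmorphD; ring.
rewrite !CintegralD ?CintegralZl ?Cintegral_cst//;
  do ?[exact: bounded_measurable_mul | apply: bounded_measurable_add].
by ring.
Qed.

(** The hypothesis and the conclusion are linear in [Z], and the conclusion is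
    linear in [h], so that it suffices to treat the real and imaginary parts. *)
Lemma Cintegral_mul_indep (Z : T -> R[i]) (h : S -> R[i]) :
  bounded_measurable Z -> bounded_measurable h ->
  (forall B, measurable B -> \intC[P]_w (Z w * (\1_B (X w) : R)%:C) =
    \intC[P]_w Z w * (fine (P (X @^-1` B)))%:C) ->
  \intC[P]_w (Z w * h (X w)) = \intC[P]_w Z w * \intC[P]_w h (X w).
Proof.
move=> bZ bh HZ.
have [/measurable_complexP[mZr mZi] [M ZM]] := bZ.
have [/measurable_complexP[mhr mhi] [N hN]] := bh.
have Zr w := Re_le_norm (ZM w); have Zi w := Im_le_norm (ZM w).
have hr x := Re_le_norm (hN x); have hi x := Im_le_norm (hN x).
have CE z : z = (complex.Re z)%:C + 'i%C * (complex.Im z)%:C :> R[i].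
  exact: complexE.
have HR B : measurable B ->
    \intC[P]_w ((complex.Re (Z w))%:C * (\1_B (X w) : R)%:C) =
    \intC[P]_w (complex.Re (Z w))%:C * (fine (P (X @^-1` B)))%:C.
  move=> /HZ /(congr1 (@complex.Re R)).
  rewrite ReM /= mulr0 subr0 => HE.
  under eq_Cintegral do rewrite -rmorphM /=.
  rewrite !Cintegral_real -rmorphM -HE; congr (_%:C).
  by apply: eq_Rintegral => w _; rewrite ReM /= mulr0 subr0.
have HI B : measurable B ->
    \intC[P]_w ((complex.Im (Z w))%:C * (\1_B (X w) : R)%:C) =
    \intC[P]_w (complex.Im (Z w))%:C * (fine (P (X @^-1` B)))%:C.
  move=> /HZ /(congr1 (@complex.Im R)).
  rewrite ImM /= mulr0 add0r => HE.
  under eq_Cintegral do rewrite -rmorphM /=.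
  rewrite !Cintegral_real -rmorphM -HE; congr (_%:C).
  by apply: eq_Rintegral => w _; rewrite ImM /= mulr0 add0r.
have rr := Cintegral_mul_real mZr Zr mhr hr HR.
have ri := Cintegral_mul_real mZr Zr mhi hi HR.
have ir := Cintegral_mul_real mZi Zi mhr hr HI.
have ii := Cintegral_mul_real mZi Zi mhi hi HI.
have bZr := real_bounded mZr Zr; have bZi := real_bounded mZi Zi.
have bhr : bounded_measurable (fun w => (complex.Re (h (X w)))%:C).
  by apply: (real_bounded (M := N)) => //; exact: measurableT_comp mhr mX.
have bhi : bounded_measurable (fun w => (complex.Im (h (X w)))%:C).
  by apply: (real_bounded (M := N)) => //; exact: measurableT_comp mhi mX.
have bc c : bounded_measurable (fun _ : T => c) by exact: bounded_measurable_cst.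
under [in RHS]eq_Cintegral do rewrite [Z _]CE.
under [X in _ = _ * X]eq_Cintegral do rewrite [h _]CE.
transitivity (\intC[P]_w
  (((complex.Re (Z w))%:C * (complex.Re (h (X w)))%:C +
    (- 1) * ((complex.Im (Z w))%:C * (complex.Im (h (X w)))%:C)) +
   ('i%C * ((complex.Re (Z w))%:C * (complex.Im (h (X w)))%:C) +
    'i%C * ((complex.Im (Z w))%:C * (complex.Re (h (X w)))%:C)))).
  (* Writing -1 as the square of i makes the goal a polynomial identity. *)
  apply: eq_Cintegral => w; rewrite {1}[Z w]CE {1}[h (X w)]CE -(@sqr_i R).
  by ring.
rewrite !CintegralD ?CintegralZl ?rr ?ri ?ir ?ii;
  do ?[exact: bounded_measurable_mul | apply: bounded_measurable_add
      | apply: bounded_measurable_mul] => //.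
by rewrite -(@sqr_i R); ring.
Qed.

End decorrelation.

(** * Independent sequences and an independent integer *)

Lemma Cintegral_distribution (R : realType) d d' (T : measurableType d)
    (S : measurableType d') (P : probability T R) (X : {RV P >-> S})
    (h : S -> R[i]) : bounded_measurable h ->
  \intC[distribution P X]_x h x = \intC[P]_w h (X w).
Proof.
move=> bh; have [/measurable_complexP[mr mi] [M hM]] := bh.
have mX : measurable_fun setT X by [].
rewrite /Cintegral /Rintegral; congr (fine _ +i* fine _).
- rewrite integral_pushforward//; first exact/measurable_EFinP.
  apply: (@bounded_integrable _ _ _ P _ M); first exact: (measurableT_comp mr).
  by move=> w; exact: Re_le_norm.
- rewrite integral_pushforward//; first exact/measurable_EFinP.
  apply: (@bounded_integrable _ _ _ P _ M); first exact: (measurableT_comp mi).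
  by move=> w; exact: Im_le_norm.
Qed.

Lemma Cintegral_law (R : realType) d d' (T : measurableType d)
    (S : measurableType d') (P : probability T R) (X : {RV P >-> S})
    (m : probability S R) (h : S -> R[i]) :
  has_law X m -> bounded_measurable h ->
  \intC[P]_w h (X w) = \intC[m]_x h x.
Proof.
move=> lawX bh; rewrite -Cintegral_distribution// /Cintegral /Rintegral.
by congr (fine _ +i* fine _); apply: eq_measure_integral => A mA _; exact: lawX.
Qed.

Section independent_product.
Context {R : realType} {d d' : measure_display}.
Context {T : measurableType d} {S : measurableType d'}.
Variables (P : probability T R) (m : probability S R).
Variables (X : nat -> {RV P >-> S}) (N : {RV P >-> nat}).
Hypotheses (lawX : forall a, has_law (X a) m) (indepX : mutually_independent X).
Hypothesis indepN : independent_of_sequence N X.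

Let cylinder (J : seq nat) (A : nat -> set S) : set T :=
  \bigcap_(a in [set` J]) (X a @^-1` A a).

Let measurable_preimage a (B : set S) : measurable B -> measurable (X a @^-1` B).
Proof. by move=> mB; rewrite -[X a @^-1` B]setTI; exact: measurable_funP. Qed.

Let measurable_cylinder J A : (forall a, measurable (A a)) ->
  measurable (cylinder J A).
Proof.
by move=> mA; apply: bigcap_measurableType => a _; exact: measurable_preimage.
Qed.

Let sigma_cylinder J A : (forall a, measurable (A a)) ->
  sigma_of_sequence X (cylinder J A).
Proof.
move=> mA.
apply: (@bigcap_measurableType _ (g_sigma_algebraType
  (\bigcup_a preimage_set_system setT (X a) measurable))) => a _.
by apply: sub_sigma_algebra; exists a => //; exists (A a); rewrite ?setTI.
Qed.

Let law_preimage a (B : set S) : measurable B ->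
  P (X a @^-1` B) = (fine (m B))%:E.
Proof. by move=> mB; rewrite fineK ?fin_num_measure// -(lawX a mB). Qed.

(** Induction on [j], the number of variables that appear through [h]; the cylinder
    on [J] keeps the later ones as events. Having arbitrary cylinders in the
    statement is what makes the step possible: enlarging [J] by [j] is the rule
    for events of [X j] that [Cintegral_mul_indep] converts into a rule for
    [h (X j)]. The case of interest is that of an empty [J]. *)
Lemma Cintegral_prod_cylinder (t j : nat) (h : S -> R[i]) (J : seq nat)
    (A : nat -> set S) : bounded_measurable h -> uniq J -> all (leq j) J ->
  (forall a, measurable (A a)) ->
  \intC[P]_w ((\1_(N @^-1` [set t]) w : R)%:C * \prod_(b < j) h (X b w) *
              (\1_(\bigcap_(a in [set` J]) (X a @^-1` A a)) w : R)%:C) =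
  (fine (P (N @^-1` [set t])))%:C * (\intC[m]_x h x) ^+ j *
    (\prod_(a <- J) fine (m (A a)))%:C.
Proof.
move=> bh; have mt : measurable (N @^-1` [set t]).
  by rewrite -[_ @^-1` _]setTI; exact: measurable_funP.
elim: j J A => [|j IH] J A uJ allJ mA; rewrite -/(cylinder J A).
  under eq_Cintegral do rewrite big_ord0 mulr1 -rmorphM /=.
  transitivity (\intC[P]_w (\1_(N @^-1` [set t] `&` cylinder J A) w : R)%:C).
    by apply: eq_Cintegral => w; rewrite indicI.
  rewrite Cintegral_indic; last exact: measurableI (measurable_cylinder _ mA).
  rewrite expr0 mulr1 -rmorphM; congr (_%:C).
  rewrite (indepN _ (sigma_cylinder _ mA))// (indepX uJ mA).
  have -> : (\prod_(a <- J) P (X a @^-1` A a))%E =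
      (\prod_(a <- J) fine (m (A a)))%:E.
    by rewrite -prodEFin; apply: eq_bigr => a _; exact: law_preimage.
  by rewrite fineM// fin_num_measure.
have jJ : j \notin J by apply/negP => /(allP allJ); rewrite ltnn.
have allJ' : all (leq j) J by apply: sub_all allJ => a /ltnW.
pose Z w := (\1_(N @^-1` [set t]) w : R)%:C * \prod_(b < j) h (X b w) *
              (\1_(cylinder J A) w : R)%:C.
have bhX b : bounded_measurable (fun w => h (X b w)).
  exact: bounded_measurable_comp.
have bZ : bounded_measurable Z.
  apply: bounded_measurable_mul; last first.
    exact: bounded_measurable_indic (measurable_cylinder _ mA).
  apply: bounded_measurable_mul; first exact: bounded_measurable_indic.
  exact: bounded_measurable_prod.
have EZ : \intC[P]_w Z w = (fine (P (N @^-1` [set t])))%:C *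
    (\intC[m]_x h x) ^+ j * (\prod_(a <- J) fine (m (A a)))%:C.
  exact: IH.
transitivity (\intC[P]_w (Z w * h (X j w))).
  by apply: eq_Cintegral => w; rewrite big_ord_recr /= /Z; ring.
rewrite (@Cintegral_mul_indep _ _ _ _ _ P (X j))//.
  by rewrite EZ (Cintegral_law (lawX j) bh) exprS; ring.
move=> B mB; rewrite EZ law_preimage//=.
(* The event [B] of [X j] is absorbed into the cylinder. *)
pose A' a := if a == j then B else A a.
have A'E a : a \in J -> A' a = A a.
  by rewrite /A'; case: eqP => // ->; rewrite (negbTE jJ).
have := IH (j :: J) A' _ _ _; rewrite /= jJ uJ leqnn allJ' => /(_ _ _ _)/=.
have mA' a : measurable (A' a) by rewrite /A'; case: eqP.
move=> /(_ isT isT mA'); rewrite big_cons {2}/A' eqxx.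
have -> : \prod_(a <- J) fine (m (A' a)) = \prod_(a <- J) fine (m (A a)).
  by rewrite !big_seq; apply: eq_bigr => a /A'E ->.
have cylE : cylinder (j :: J) A' = X j @^-1` B `&` cylinder J A.
  rewrite /cylinder !bigcap_seq big_cons {1}/A' eqxx; congr (_ `&` _).
  by rewrite !big_seq; apply: eq_bigr => a /A'E ->.
rewrite -/(cylinder (j :: J) A') cylE rmorphM [_%:C * _%:C]mulrC mulrA => <-.
by apply: eq_Cintegral => w; rewrite indicI /Z /= rmorphM; ring.
Qed.

End independent_product.

(** * Averaging over a geometric law *)

Section geometric_mixture.
Context {R : realType} {d : measure_display} {T : measurableType d}.
Variables (P : probability T R) (N : {RV P >-> nat}) (alpha : R).
Hypothesis alpha01 : 0 < alpha < 1.
Hypothesis lawN : forall t : nat,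
  P (N @^-1` [set t]) = ((1 - alpha) * alpha ^+ t)%:E.

Let tail n : set T := N @^-1` [set t | (n <= t)%N].

Let measurable_preN (B : set nat) : measurable (N @^-1` B).
Proof.
have mN : measurable_fun setT N by [].
by rewrite -[_ @^-1` _]setTI; apply: mN.
Qed.

Let tail_split n w :
  \1_(tail n) w = \1_(N @^-1` [set n]) w + \1_(tail n.+1) w :> R.
Proof.
rewrite !indicE /tail.
have memE (b : pred nat) : (w \in N @^-1` [set t | b t]) = b (N w).
  by apply/idP/idP; rewrite !inE.
have -> : (w \in N @^-1` [set n]) = (N w == n).
  by apply/idP/idP; rewrite !inE => /eqP.
by rewrite !memE; case: ltngtP; rewrite ?add0r ?addr0.
Qed.

Let tail_measure n : \int[P]_w \1_(tail n) w = alpha ^+ n.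
Proof.
have intE (B : set nat) : \int[P]_w (\1_(N @^-1` B) w) = fine (P (N @^-1` B)).
  by rewrite /Rintegral integral_indic ?setIT.
have i1 (B : set nat) : P.-integrable setT (EFin \o \1_(N @^-1` B)).
  apply: (@bounded_integrable _ _ _ P _ 1).
    exact: measurable_indic (measurable_preN _).
  by move=> w; rewrite indicE; case: (_ \in _); rewrite ?normr1 ?normr0.
elim: n => [|n IHn].
  have T0 : N @^-1` [set t | (0 <= t)%N] = setT by apply/seteqP; split.
  by rewrite intE T0 (_ : P setT = 1%E)// probability_setT.
move: IHn; under eq_Rintegral do rewrite tail_split.
rewrite RintegralD//; [|exact: i1..].
rewrite intE lawN /= exprS => ?; lra.
Qed.

(** Both [r n], the part of the mean carried by [n <= N], and [s * z ^+ n], the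
    remainder of the geometric series, drop by [(1 - alpha)%:C * z ^+ n] from [n]
    to [n.+1]. Their difference is thus constant, and it is bounded by a multiple
    of [alpha ^+ n]. *)
Lemma Cintegral_geometric_mixture (F : T -> R[i]) (c : R[i]) :
  bounded_measurable F -> `|c| <= 1 ->
  (forall t, \intC[P]_w ((\1_(N @^-1` [set t]) w : R)%:C * F w) =
             ((1 - alpha) * alpha ^+ t)%:C * c ^+ t) ->
  \intC[P]_w F w = 1 / (1 + (alpha / (1 - alpha))%:C * (1 - c)).
Proof.
move=> bF c1 EF; have /andP[a0 a1] := alpha01.
have [M FM] := bF.2.
have a0C : 0 <= alpha%:C :> R[i] by rewrite ler0c ltW.
set z := alpha%:C * c.
have z1 : 1 - z != 0.
  rewrite subr_eq0; apply/eqP => zE.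
  have : `|z| < 1.
    rewrite normrM (ger0_norm a0C).
    by rewrite (le_lt_trans (_ : _ <= alpha%:C)) ?ltcR// ler_piMr.
  by rewrite -zE normr1 ltxx.
set s := (1 - alpha)%:C / (1 - z).
pose r n := \intC[P]_w ((\1_(tail n) w : R)%:C * F w).
have b1 (B : set nat) : bounded_measurable (fun w => (\1_(N @^-1` B) w : R)%:C).
  exact: bounded_measurable_indic.
have rS n : r n = (1 - alpha)%:C * z ^+ n + r n.+1.
  rewrite /r; under eq_Cintegral do rewrite tail_split rmorphD mulrDl.
  rewrite CintegralD; [|exact: bounded_measurable_mul (b1 _) bF..].
  by rewrite EF /z exprMn rmorphM /= rmorphXn mulrA.
have rE n : \intC[P]_w F w - s = r n - s * z ^+ n.
  elim: n => [|n ->].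
    rewrite expr0 mulr1; congr (_ - s); apply: eq_Cintegral => w.
    by rewrite indicE mem_set ?mul1r.
  by rewrite rS exprS /s; field.
have rn n : `|r n| <= (`|M| * alpha ^+ n)%:C.
  have -> : `|M| * alpha ^+ n = \int[P]_w (`|M| * \1_(tail n) w).
    rewrite RintegralZl ?tail_measure//.
    apply: (@bounded_integrable _ _ _ P _ 1).
      exact: measurable_indic (measurable_preN _).
    by move=> w; rewrite indicE; case: (_ \in _); rewrite ?normr1 ?normr0.
  apply: Cintegral_le_norm; first exact: bounded_measurable_mul (b1 _) bF.
    apply: (@bounded_integrable _ _ _ P _ `|M|).
      by apply: measurable_funM => //; exact: measurable_indic (measurable_preN _).
    move=> w; rewrite indicE.
    by case: (_ \in _); rewrite ?mulr1 ?mulr0 ?normr_id ?normr0.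
  move=> w; rewrite indicE; case: (_ \in _); last by rewrite mul0r mulr0 normr0.
  by rewrite mul1r mulr1 (le_trans (FM w))// lecR ler_norm.
have cvg0 (K : R) x : (forall n, x <= K * alpha ^+ n) -> x <= 0.
  move=> xK; have K0 : geometric K alpha @ \oo --> (0 : R).
    by apply: cvg_geometric; rewrite ger0_norm// ltW.
  have /cvg_lim <- // := K0.
  by apply: limr_ge; [apply/cvg_ex; exists 0|exact: nearW].
have sE : `|s| = (complex.Re `|s|)%:C by rewrite RRe_real ?normr_real.
(* The constant difference is at most [(`|M| + `|s|) * alpha ^+ n] for all [n]. *)
have : complex.Re `|\intC[P]_w F w - s| <= 0.
  apply: (cvg0 (`|M| + complex.Re `|s|)) => n.
  rewrite -lecR RRe_real ?normr_real// (rE n) (le_trans (ler_normB _ _))//.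
  rewrite mulrDl rmorphD /= lerD// normrM rmorphM /= -sE.
  rewrite ler_wpM2l// normrX normrM (ger0_norm a0C).
  by rewrite exprMn rmorphXn /= ler_piMr ?exprn_ge0// exprn_ile1.
rewrite -lecR RRe_real ?normr_real// normr_le0 subr_eq0 => /eqP ->.
have a1C : (1 - alpha)%:C != 0 :> R[i].
  by rewrite -(rmorph0 (real_complex R)) (inj_eq (@complexI R)) subr_eq0 gt_eqF.
rewrite /s rmorphM /= fmorphV; move: a1C z1; rewrite /z !rmorphB !rmorph1 /= => ? ?.
have -> : 1 + alpha%:C / (1 - alpha%:C) * (1 - c) =
    (1 - alpha%:C * c) / (1 - alpha%:C) by field.
by field; apply/andP.
Qed.

End geometric_mixture.

Section geometric_product.
Context {R : realType} {d d' : measure_display}.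
Context {T : measurableType d} {S : measurableType d'}.
Variables (P : probability T R) (m : probability S R) (alpha : R).
Variables (X : nat -> {RV P >-> S}) (N : {RV P >-> nat}).
Hypothesis alpha01 : 0 < alpha < 1.
Hypotheses (lawX : forall a, has_law (X a) m) (indepX : mutually_independent X).
Hypothesis lawN : forall t : nat,
  P (N @^-1` [set t]) = ((1 - alpha) * alpha ^+ t)%:E.
Hypothesis indepN : independent_of_sequence N X.

(** The level sets of [N] cut the domain into countably many pieces, on each of
    which the function coincides with a measurable one. *)
Lemma bounded_measurable_at (G : nat -> T -> R[i]) :
  (forall n, measurable_fun setT (G n)) ->
  (forall n w, `|G n w| <= 1) -> bounded_measurable (fun w => G (N w) w).
Proof.
move=> mG G1; split; last by exists 1.
move=> _ B mB; rewrite setTI.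
have -> : (fun w => G (N w) w) @^-1` B =
    \bigcup_n (N @^-1` [set n] `&` G n @^-1` B).
  apply/seteqP; split => [w Bw|w [n _ [/= <-]]] //.
  by exists (N w).
apply: bigcupT_measurable => n; apply: measurableI.
  have mN : measurable_fun setT N by [].
  by rewrite -[_ @^-1` _]setTI; apply: mN.
by rewrite -[_ @^-1` _]setTI; exact: mG.
Qed.

Variable h : S -> R[i].
Hypotheses (mh : measurable_fun setT h) (h1 : forall x, `|h x| <= 1).

Let bh : bounded_measurable h. Proof. by split=> //; exists 1. Qed.

Let norm_mean : `|\intC[m]_x h x| <= 1.
Proof.
have m1 : (\int[m]_x (1 : R)) = 1.
  have m1 : fine (m setT) = 1 by rewrite (_ : m setT = 1%E)// probability_setT.
  by rewrite Rintegral_cst// mul1r.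
rewrite -[leRHS](rmorph1 (real_complex R)) -m1.
apply: Cintegral_le_norm => //.
by apply: (@bounded_integrable _ _ _ m _ 1) => // x; rewrite normr1.
Qed.

Lemma Cintegral_geometric_exp :
  \intC[P]_w (\intC[m]_x h x) ^+ N w =
  1 / (1 + (alpha / (1 - alpha))%:C * (1 - \intC[m]_x h x)).
Proof.
apply: (Cintegral_geometric_mixture alpha01 lawN _ norm_mean).
  apply: (bounded_measurable_at (G := fun n _ => (\intC[m]_x h x) ^+ n)).
    by move=> n; exact: measurable_cst.
  by move=> n _; rewrite normrX exprn_ile1.
move=> t; have mt : measurable (N @^-1` [set t]).
  by rewrite -[_ @^-1` _]setTI; exact: measurable_funP.
transitivity (\intC[P]_w ((\intC[m]_x h x) ^+ t * (\1_(N @^-1` [set t]) w : R)%:C)).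
  apply: eq_Cintegral => w; rewrite mulrC indicE.
  by have [|_] := boolP (_ \in _); [rewrite inE => -> | rewrite !mulr0].
rewrite CintegralZl ?Cintegral_indic ?lawN//; last exact: bounded_measurable_indic.
by rewrite mulrC.
Qed.

Lemma Cintegral_geometric_prod :
  \intC[P]_w \prod_(b < N w) h (X b w) =
  1 / (1 + (alpha / (1 - alpha))%:C * (1 - \intC[m]_x h x)).
Proof.
have bhX b : bounded_measurable (fun w => h (X b w)).
  exact: bounded_measurable_comp.
apply: (Cintegral_geometric_mixture alpha01 lawN _ norm_mean).
  apply: (bounded_measurable_at (G := fun n w => \prod_(b < n) h (X b w))).
    by move=> n; have [] := bounded_measurable_prod (index_enum 'I_n) bhX.
  by move=> n w; rewrite normr_prod; apply: prodr_ile1 => b _; rewrite normr_ge0 h1.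
move=> t.
have := @Cintegral_prod_cylinder _ _ _ _ _ P m X N lawX indepX indepN t t h [::]
  (fun=> setT) bh isT isT (fun=> measurableT).
rewrite big_nil rmorph1 mulr1 lawN /= => <-; apply: eq_Cintegral => w.
rewrite set_nil bigcap_set0 indicT mulr1 indicE.
by have [|_] := boolP (_ \in _); [rewrite inE => -> | rewrite !mul0r].
Qed.

End geometric_product.

(** * The spectrum and the closed disc *)

Section spectrum.
Context (R : realType) (q : nat) (hq : (2 <= q)%N).

Lemma measurable_coef (k : 'I_q) :
  measurable_fun setT (coef k : spectrum R hq -> R[i]).
Proof.
move=> _ B mB; apply: sub_sigma_algebra.
by rewrite (bigD1 k) //=; left; exists B.
Qed.

Lemma norm_theta1 : `|theta1 R q| = 1.
Proof. by rewrite normc_def /= cos2Dsin2 sqrtr1. Qed.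

(** A Fourier coefficient is an average of roots of unity. *)
Lemma coef_disc (k : 'I_q) (x : spectrum R hq) : `|coef k x| <= 1.
Proof.
have [p [p0 p1] px] := set_valP x.
rewrite /coef -px ffunE (le_trans (ler_norm_sum _ _ _))//.
rewrite -(rmorph1 (real_complex R)) -p1 rmorph_sum ler_sum// => j _.
by rewrite normrM normrX norm_theta1 expr1n mul1r ger0_norm ?ler0c.
Qed.

(** Measurability of a function on a set only gives measurable preimages once that
    set is known to be measurable, so this unlocks the hypothesis on the [f k]. *)
Lemma measurable_closed_disc : measurable (closed_disc R).
Proof.
exists [set u : R * R | u.1 ^+ 2 + u.2 ^+ 2 <= 1].
  rewrite -[X in measurable X]setTI.
  apply: measurable_fun_le => //; apply: measurable_funD; apply: measurable_funX.
    exact: measurable_fst.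
  exact: measurable_snd.
have norm_le1 (z : R[i]) :
    (`|z| <= 1) = (complex.Re z ^+ 2 + complex.Im z ^+ 2 <= 1).
  rewrite normc_def -[leRHS](rmorph1 (real_complex R)) lecR -[X in _ <= X]sqrtr1.
  by rewrite ler_sqrt.
by rewrite setTI; apply/seteqP; split => z; rewrite /closed_disc /= norm_le1.
Qed.

End spectrum.

(** * Generating functional and moments of the products of points *)

Theorem lemma1 (R : realType) (q : nat) (hq : (2 <= q)%N)
    (mu : probability (simplex R hq) R)
    (alpha : R) (halpha : 0 < alpha < 1)
    (d : measure_display) (Omega : measurableType d) (P : probability Omega R)
    (xi : nat -> {RV P >-> spectrum R hq}) (T : {RV P >-> nat})
    (xi_law : forall a, has_law (xi a) (nu mu))
    (xi_indep : mutually_independent xi)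
    (T_law : forall t : nat,
      P (T @^-1` [set t]) = ((1 - alpha) * alpha ^+ t)%:E)
    (T_indep : independent_of_sequence T xi) :
  (forall f : frequency q -> R[i] -> R[i],
     (forall k, measurable_fun (closed_disc R) (f k)) ->
     (forall k, set_fun (closed_disc R) (closed_disc R) (f k)) ->
     let G := \intC[P]_w \prod_(b < T w)
       \intC[nu mu]_x \prod_(k : frequency q) f k (coef (val k) x) in
     joint_pgfl P (point_process xi T) f = G /\
     G = 1 / (1 + (alpha / (1 - alpha))%:C *
       \intC[nu mu]_x (1 - \prod_(k : frequency q) f k (coef (val k) x)))) /\
  (forall l : frequency q -> nat,
     1 / (1 + (alpha / (1 - alpha))%:C * (1 - kappa mu l)) =
     \intC[P]_w \prod_(k : frequency q)
       product_of_points (point_process xi T) k w ^+ l k).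
Proof.
have compound := Cintegral_geometric_prod halpha xi_law xi_indep T_law T_indep.
split=> [f mf f1 G|l].
- pose h (x : spectrum R hq) : R[i] := \prod_(k : frequency q) f k (coef (val k) x).
  have fk_disc k x : `|f k (coef (val k) x)| <= 1.
    by apply: f1; exact: coef_disc.
  have h1 x : `|h x| <= 1.
    rewrite normr_prod; apply: prodr_ile1 => k _.
    by rewrite normr_ge0 fk_disc.
  have mh : measurable_fun setT h.
    suff [] : bounded_measurable h by [].
    apply: bounded_measurable_prod => k; split; last by exists 1 => x.
    apply: (measurable_comp (measurable_closed_disc R)) (mf k) (measurable_coef _).
    by move=> _ [x _ <-]; exact: coef_disc.
  have GE : G = 1 / (1 + (alpha / (1 - alpha))%:C * (1 - \intC[nu mu]_x h x)).
    rewrite -(Cintegral_geometric_exp (nu mu) halpha T_law mh h1) /G.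
    by apply: eq_Cintegral => w; rewrite prodr_const card_ord.
  split.
    rewrite GE -(compound h mh h1); apply: eq_Cintegral => w.
    under eq_bigr do rewrite big_map.
    by rewrite exchange_big /= -{1}[T w]subn0 big_mkord.
  rewrite GE; congr (1 / (1 + _ * _)).
  have bh : bounded_measurable h by split; [|exists 1].
  transitivity (\intC[nu mu]_x (1 + (-1) * h x)).
    by rewrite CintegralD ?CintegralZl ?Cintegral_cst ?mulN1r//;
      [exact: bounded_measurable_cst|apply: bounded_measurable_mul => //;
       exact: bounded_measurable_cst].
  by apply: eq_Cintegral => x; rewrite mulN1r.
- pose h (x : spectrum R hq) : R[i] := \prod_(k : frequency q) coef (val k) x ^+ l k.
  have h1 x : `|h x| <= 1.
    rewrite normr_prod; apply: prodr_ile1 => k _.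
    by rewrite normr_ge0 normrX exprn_ile1 ?coef_disc.
  have bh : bounded_measurable h.
    apply: bounded_measurable_prod => k; apply: bounded_measurable_exp; split.
      exact: measurable_coef.
    by exists 1 => x; exact: coef_disc.
  have -> : kappa mu l = \intC[nu mu]_x h x.
    rewrite Cintegral_distribution//; apply: eq_Cintegral => p.
    by apply: eq_bigr => k _; rewrite /coef /= ffunE.
  rewrite -(compound h bh.1 h1); apply: eq_Cintegral => w.
  apply/esym; under eq_bigr do rewrite /product_of_points big_map -prodrXl.
  by rewrite exchange_big /= -{1}[T w]subn0 big_mkord.
Qed.
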